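(* Let $(X,\mathcal{A})$ be a measurable space and let $\mu\colon\mathcal{A}\to[0,\infty]$ be a nonadditive measure. Assume that $\mu$ has property (C) and the pseudometric generating property (p.g.p.). Then $\mathcal{L}^0(\mu)$ is complete. If $\mu$ is additionally assumed to be null-additive, then $L^0(\mu)$ is complete.
   Context: $X$ is a nonempty set and $\mathcal{A}$ is a $\sigma$-field of subsets of $X$. A nonadditive measure is a set function $\mu\colon\mathcal{A}\to[0,\infty]$ with $\mu(\emptyset)=0$ and $\mu(A)\le\mu(B)$ whenever $A,B\in\mathcal{A}$, $A\subset B$. $\mathcal{F}_0(X)$ is the real linear space of all $\mathcal{A}$-measurable functions $X\to\mathbb{R}$. Property (C): for any sequence $\{E_n\}_{n\in\mathbb{N}}\subset\mathcal{A}$, if $\sup_{l\in\mathbb{N}}\mu\left(\bigcup_{n=k}^{k+l}E_n\right)\to 0$ as $k\to\infty$, then $\mu\left(\bigcup_{n=k}^\infty E_n\right)\to 0$ as $k\to\infty$. (p.g.p.): $\mu(A_n\cup B_n)\to 0$ whenever $A_n,B_n\in\mathcal{A}$ and $\max\{\mu(A_n),\mu(B_n)\}\to 0$. Null-additive: $\mu(A\cup B)=\mu(A)$ whenever $A,B\in\mathcal{A}$ and $\mu(B)=0$. Let $\varphi\colon[0,\infty]\to[0,\pi/2]$, $\varphi(t)=\arctan t$ for $t\neq\infty$ and $\varphi(\infty)=\pi/2$. For $f\in\mathcal{F}_0(X)$ let $\|f\|_0:=\inf_{c>0}\varphi\bigl(c+\mu(\{|f|>c\})\bigr)$. The space $\mathcal{F}_0(X)$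 equipped with $\|\cdot\|_0$ is denoted $\mathcal{L}^0(\mu)$. For $\mu$ null-additive, $f\sim g$ iff $\mu(\{|f-g|>c\})=0$ for every $c>0$ defines an equivalence relation on $\mathcal{F}_0(X)$; $[f]$ is the class of $f$, $L^0(\mu):=\{[f]: f\in\mathcal{L}^0(\mu)\}$ with $[f]+[g]:=[f+g]$, $c[f]:=[cf]$, and $\|[f]\|_0:=\|f\|_0$ (well-defined when $\mu$ is null-additive). A sequence $\{x_n\}$ converges to $x$ if $\|x_n-x\|_0\to 0$; it is Cauchy if for any $\varepsilon>0$ there is $n_0$ with $\|x_m-x_n\|_0<\varepsilon$ for all $m,n\ge n_0$. Complete means that every Cauchy sequence in the space converges to an element of the space. (No triangle inequality is assumed.) *)

(* Defs.v *)
From HB Require Import structures.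
From mathcomp Require Import all_boot all_order all_algebra.
From mathcomp Require Import generic_quotient.
From mathcomp Require Import all_classical all_reals all_analysis.
(* [all_analysis] does not export the ring structure of {mfun X >-> R}. *)
From mathcomp Require Import measurable_realfun.

Set Implicit Arguments.
Unset Strict Implicit.
Unset Printing Implicit Defensive.

Import Order.TTheory GRing.Theory Num.Theory.
Import numFieldNormedType.Exports.

Local Open Scope classical_set_scope.
Local Open Scope ring_scope.

(* Set functions are total on [set X]; only their values on measurable sets
   are constrained or used. *)
Record nonadditive_measure (R : realType) (d : measure_display)
    (X : measurableType d) := NonadditiveMeasure {
  nonadditive_fun :> set X -> \bar R ;
  nonadditive0 : nonadditive_fun set0 = 0%E ;
  nonadditive_ge0 : forall A, measurable A -> (0 <= nonadditive_fun A)%E ;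
  nonadditive_le : forall A B, measurable A -> measurable B -> A `<=` B ->
    (nonadditive_fun A <= nonadditive_fun B)%E }.

Section properties.
Context {R : realType} {d : measure_display} {X : measurableType d}.
Variable mu : nonadditive_measure R X.

Definition property_C : Prop :=
  forall E : nat -> set X, (forall n, measurable (E n)) ->
    ereal_sup (range (fun l : nat =>
      mu (\bigcup_(n in [set n | (k <= n <= k + l)%N]) E n)))
      @[k --> \oo] --> (0%E : \bar R) ->
    mu (\bigcup_(n in [set n | (k <= n)%N]) E n) @[k --> \oo]
      --> (0%E : \bar R).

Definition pseudometric_generating : Prop :=
  forall A B : nat -> set X,
    (forall n, measurable (A n)) -> (forall n, measurable (B n)) ->
    maxe (mu (A n)) (mu (B n)) @[n --> \oo] --> (0%E : \bar R) ->
    mu (A n `|` B n) @[n --> \oo] --> (0%E : \bar R).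

Definition null_additive : Prop :=
  forall A B : set X, measurable A -> measurable B -> mu B = 0%E ->
    mu (A `|` B) = mu A.

End properties.

(* {mfun X >-> R} is the space F_0(X), measurability being with respect to
   the Borel sigma-algebra of R; with norm0 mu it is calligraphic L^0(mu). *)
Section norm0.
Context {R : realType} {d : measure_display} {X : measurableType d}.

(* The value at -oo is irrelevant: phi is only applied to elements of
   [0, +oo]. *)
Definition phi (t : \bar R) : R :=
  match t with
  | r%:E => atan r
  | +oo%E => pi / 2
  | -oo%E => 0
  end.

Variable mu : nonadditive_measure R X.

Definition norm0 (f : {mfun X >-> R}) : R :=
  inf [set phi (c%:E + mu [set x | (c < `|f x|)%R])%E | c in [set c : R | 0 < c]].

Definition mu_equiv (f g : {mfun X >-> R}) : Prop :=
  forall c : R, 0 < c -> mu [set x | c < `|f x - g x|] = 0%E.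

End norm0.

Section completeness.
Context {R : realType} {V : zmodType}.
Variable N : V -> R.

Definition converges_to (u : nat -> V) (a : V) : Prop :=
  N (u n - a) @[n --> \oo] --> (0 : R).

Definition is_cauchy (u : nat -> V) : Prop :=
  forall e : R, 0 < e -> exists n0 : nat,
    forall m n : nat, (n0 <= m)%N -> (n0 <= n)%N -> N (u m - u n) < e.

Definition is_complete : Prop :=
  forall u : nat -> V, is_cauchy u -> exists a : V, converges_to u a.

End completeness.

Section quotient.
Context {R : realType} {d : measure_display} {X : measurableType d}.
Variable mu : nonadditive_measure R X.

Lemma measurable_gt_norm (f : {mfun X >-> R}) (c : R) :
  measurable [set x | c < `|f x|].
Proof.
rewrite (_ : [set x | _] = (Num.norm \o f) @^-1` `]c, +oo[%classic).
  rewrite -[X in measurable X]setTI.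
  have mf : measurable_fun setT (Num.norm \o f).
    by apply: measurableT_comp => //; exact: normr_measurable.
  exact: mf.
by apply/seteqP; split=> x /=; rewrite in_itv/= andbT.
Qed.

Lemma measurable_gt_normB (f g : {mfun X >-> R}) (c : R) :
  measurable [set x | c < `|f x - g x|].
Proof. exact: (measurable_gt_norm (f - g)). Qed.

Lemma mu_equiv_refl (f : {mfun X >-> R}) : mu_equiv mu f f.
Proof.
move=> c c0; rewrite (_ : [set x | _] = set0) ?nonadditive0//.
by apply/seteqP; split=> x //=; rewrite subrr normr0 ltNge (ltW c0).
Qed.

Lemma mu_equiv_sym (f g : {mfun X >-> R}) : mu_equiv mu f g -> mu_equiv mu g f.
Proof.
move=> fg c c0; rewrite -(fg c c0); congr (mu _).
by apply/seteqP; split=> x /=; rewrite distrC.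
Qed.

Hypothesis na : null_additive mu.

Lemma null_additive_subU (A B C : set X) :
  measurable A -> measurable B -> measurable C ->
  A `<=` B `|` C -> mu C = 0%E -> (mu A <= mu B)%E.
Proof.
move=> mA mB mC ABC C0; rewrite -(na mB mC C0).
by apply: nonadditive_le => //; exact: measurableU.
Qed.

Lemma mu_equiv_split (f1 g1 f2 g2 h k : {mfun X >-> R}) :
  (forall x, `|h x - k x| <= `|f1 x - g1 x| + `|f2 x - g2 x|) ->
  mu_equiv mu f1 g1 -> mu_equiv mu f2 g2 -> mu_equiv mu h k.
Proof.
move=> hk e1 e2 c c0; have c20 : 0 < c / 2 by rewrite divr_gt0.
apply/eqP; rewrite eq_le nonadditive_ge0 ?andbT; last first.
  exact: measurable_gt_normB.
rewrite -(e1 _ c20); apply: (null_additive_subU _ _ _ _ (e2 _ c20));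
  [exact: measurable_gt_normB..|].
move=> x /= hx; case: (ltP (c / 2) `|f1 x - g1 x|) => [|h1]; first by left.
right; rewrite ltNge; apply/negP => h2.
have := lt_le_trans hx (le_trans (hk x) (lerD h1 h2)).
by rewrite -splitr ltxx.
Qed.

Lemma mu_equiv_trans (g f h : {mfun X >-> R}) :
  mu_equiv mu f g -> mu_equiv mu g h -> mu_equiv mu f h.
Proof. by apply: mu_equiv_split => x; exact: ler_distD. Qed.

Lemma mu_equivD (f f' g g' : {mfun X >-> R}) :
  mu_equiv mu f f' -> mu_equiv mu g g' -> mu_equiv mu (f + g) (f' + g').
Proof.
apply: mu_equiv_split => x /=.
by rewrite opprD addrACA ler_normD.
Qed.

Lemma mu_equivZ (c : R) (f g : {mfun X >-> R}) :
  mu_equiv mu f g -> mu_equiv mu (c *: f) (c *: g).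
Proof.
have [->|c0] := eqVneq c 0.
  by move=> _; rewrite !scale0r; exact: mu_equiv_refl.
move=> fg e e0 /=.
rewrite -(fg (e / `|c|)); last by rewrite divr_gt0 // normr_gt0.
congr (mu _); apply/seteqP; split=> x /=; rewrite ltr_pdivrMr ?normr_gt0 //;
  by rewrite -normrM mulrBl (mulrC (f x)) (mulrC (g x)).
Qed.

Lemma mu_equivN (f g : {mfun X >-> R}) :
  mu_equiv mu f g -> mu_equiv mu (- f) (- g).
Proof.
move=> fg c c0; rewrite -(fg c c0); congr (mu _).
by apply/seteqP; split=> x /=; rewrite -opprD normrN.
Qed.

Definition mu_equivb (f g : {mfun X >-> R}) : bool := `[< mu_equiv mu f g >].

Let mu_equivb_refl : reflexive mu_equivb.
Proof. by move=> f; apply/asboolP; exact: mu_equiv_refl. Qed.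

Let mu_equivb_sym : symmetric mu_equivb.
Proof. by move=> f g; apply/idP/idP => /asboolP h; apply/asboolP/mu_equiv_sym. Qed.

Let mu_equivb_trans : transitive mu_equivb.
Proof. by move=> g f h /asboolP fg /asboolP gh; apply/asboolP/(mu_equiv_trans fg). Qed.

Canonical mu_equivb_canonical :=
  EquivRel mu_equivb mu_equivb_refl mu_equivb_sym mu_equivb_trans.

Local Open Scope quotient_scope.

Definition L0_quot : Type := {eq_quot mu_equivb}.
HB.instance Definition _ := Choice.on L0_quot.
HB.instance Definition _ := EqQuotient.on L0_quot.

Definition L0_class (f : {mfun X >-> R}) : L0_quot := \pi_L0_quot f.

Lemma L0_classP (f g : {mfun X >-> R}) :
  L0_class f = L0_class g <-> mu_equiv mu f g.
Proof. by split=> [/eqmodP/asboolP|h]; last exact/eqmodP/asboolP. Qed.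

Lemma L0_class_repr (x : L0_quot) : L0_class (repr x) = x.
Proof. exact: reprK. Qed.

Lemma mu_equiv_repr (f : {mfun X >-> R}) : mu_equiv mu (repr (L0_class f)) f.
Proof. by apply/L0_classP; rewrite L0_class_repr. Qed.

Definition L0_add (x y : L0_quot) : L0_quot := L0_class (repr x + repr y).
Definition L0_opp (x : L0_quot) : L0_quot := L0_class (- repr x).
Definition L0_scale (c : R) (x : L0_quot) : L0_quot := L0_class (c *: repr x).

Lemma L0_addE (f g : {mfun X >-> R}) :
  L0_add (L0_class f) (L0_class g) = L0_class (f + g).
Proof. by apply/L0_classP; apply: mu_equivD; exact: mu_equiv_repr. Qed.

Lemma L0_oppE (f : {mfun X >-> R}) : L0_opp (L0_class f) = L0_class (- f).
Proof. by apply/L0_classP; apply: mu_equivN; exact: mu_equiv_repr. Qed.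

Lemma L0_scaleE (c : R) (f : {mfun X >-> R}) :
  L0_scale c (L0_class f) = L0_class (c *: f).
Proof. by apply/L0_classP; apply: mu_equivZ; exact: mu_equiv_repr. Qed.

Let L0_addA : associative L0_add.
Proof.
move=> x y z; rewrite -[x]L0_class_repr -[y]L0_class_repr -[z]L0_class_repr.
by rewrite !L0_addE addrA.
Qed.

Let L0_addC : commutative L0_add.
Proof. by move=> x y; rewrite /L0_add addrC. Qed.

Let L0_add0 : left_id (L0_class 0) L0_add.
Proof. by move=> x; rewrite -[x]L0_class_repr L0_addE add0r. Qed.

Let L0_addN : left_inverse (L0_class 0) L0_opp L0_add.
Proof. by move=> x; rewrite -[x]L0_class_repr L0_oppE L0_addE addNr. Qed.

HB.instance Definition _ :=
  GRing.isZmodule.Build L0_quot L0_addA L0_addC L0_add0 L0_addN.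

Let L0_scaleA (a b : R) (x : L0_quot) :
  L0_scale a (L0_scale b x) = L0_scale (a * b) x.
Proof. by rewrite -[x]L0_class_repr !L0_scaleE scalerA. Qed.

Let L0_scale1 : left_id 1 L0_scale.
Proof. by move=> x; rewrite -[x]L0_class_repr L0_scaleE scale1r. Qed.

Let L0_scaleDr : right_distributive L0_scale +%R.
Proof.
move=> a x y; rewrite -[x]L0_class_repr -[y]L0_class_repr.
rewrite [X in L0_scale a X](L0_addE (repr x)) !L0_scaleE.
by rewrite [RHS]L0_addE scalerDr.
Qed.

Let L0_scaleDl (x : L0_quot) : {morph L0_scale^~ x : a b / a + b}.
Proof.
move=> a b; rewrite -[x]L0_class_repr !L0_scaleE [RHS]L0_addE.
by rewrite scalerDl.
Qed.

HB.instance Definition _ := GRing.Zmodule_isLmodule.Build R L0_quot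
  L0_scaleA L0_scale1 L0_scaleDr L0_scaleDl.

Lemma L0_classD (f g : {mfun X >-> R}) :
  L0_class f + L0_class g = L0_class (f + g).
Proof. exact: L0_addE. Qed.

Lemma L0_classZ (c : R) (f : {mfun X >-> R}) :
  c *: L0_class f = L0_class (c *: f).
Proof. exact: L0_scaleE. Qed.

(* Independent of the representative by norm0_quotE. *)
Definition norm0_quot (x : L0_quot) : R := norm0 mu (repr x).

Lemma phi_homo (s t : \bar R) : (0 <= s)%E -> (s <= t)%E -> phi s <= phi t.
Proof.
case: s t => [s| |] [t| |] //=; rewrite ?lee_fin => s0 st; first exact: le_atan.
exact/ltW/atan_ltpi2.
Qed.

Lemma norm0_le_mu_equiv (f g : {mfun X >-> R}) :
  mu_equiv mu f g -> norm0 mu f <= norm0 mu g.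
Proof.
move=> fg; apply: lb_le_inf.
  by exists (phi (1%:E + mu [set x | (1 < `|g x|)%R])%E); exists 1 => //=.
move=> _ [c /= c0 <-].
have mug0 : (0 <= mu [set x | (c < `|g x|)%R])%E.
  by apply: nonadditive_ge0; exact: measurable_gt_norm.
have bound e : 0 < e ->
    norm0 mu f <= phi ((c + e)%:E + mu [set x | (c < `|g x|)%R])%E.
  move=> e0; have ce0 : 0 < c + e by rewrite addr_gt0.
  apply: (@le_trans _ _ (phi ((c + e)%:E + mu [set x | (c + e < `|f x|)%R])%E)).
    apply: ge_inf; last by exists (c + e).
    exists 0 => _ [t /= t0 <-].
    rewrite -[leLHS](@atan0 R) -[leLHS]/(phi 0%:E).
    apply: phi_homo => //.
    by rewrite adde_ge0 ?lee_fin ?(ltW t0)//;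
      apply: nonadditive_ge0; exact: measurable_gt_norm.
  apply: phi_homo.
    by rewrite adde_ge0 ?lee_fin ?(ltW ce0)//;
      apply: nonadditive_ge0; exact: measurable_gt_norm.
  apply: leeD2l; apply: (null_additive_subU _ _ _ _ (fg e e0));
    [exact: measurable_gt_norm..|exact: measurable_gt_normB|].
  move=> x /= hx; case: (ltP c `|g x|) => [|h1]; first by left.
  right; rewrite ltNge; apply/negP => h2.
  have : `|f x| <= c + e.
    by rewrite -[f x](subrK (g x)) addrC (le_trans (ler_normD _ _)) ?lerD.
  by rewrite leNgt hx.
move: mug0 bound; case: (mu _) => [m| |] //= _ bound; last exact: (bound 1).
have cv : atan (c + e + m) @[e --> 0^'+] --> atan (c + m).
  rewrite -[X in _ --> atan (X + _)]addr0; apply: cvg_at_right_filter.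
  apply: (continuous_cvg _ (@continuous_atan R (c + 0 + m))).
  by apply: cvgD; [apply: cvgD; [exact: cvg_cst|exact: cvg_id]|exact: cvg_cst].
apply: (cvgr_to_ge cv).
by near=> e; apply: bound; near: e; exact: nbhs_right_gt.
Unshelve. all: end_near. Qed.

Lemma norm0_quotE (f : {mfun X >-> R}) : norm0_quot (L0_class f) = norm0 mu f.
Proof.
have h := mu_equiv_repr f.
by apply/eqP; rewrite eq_le !norm0_le_mu_equiv //; exact: mu_equiv_sym.
Qed.

End quotient.

(* Main.v *)
(* By (p.g.p.) there are radii delta_k, at least halving at each step, such that
   the union of two sets of measure less than delta_(k+1) has measure less than
   delta_k.  A Cauchy sequence has a subsequence (v_k) for which
   E_k = {|v_k - v_(k+1)| > delta_(k+1)} has measure less than delta_(k+1); by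
   induction on l, E_k `|` ... `|` E_(k+l) has measure less than delta_k, so (C)
   makes the measure of the union of the E_n, n >= k, tend to 0.  Outside that
   union (v_n) converges, with |v_k - lim v_n| <= delta_k; a last use of (p.g.p.)
   passes from the subsequence to the whole sequence. *)
From HB Require Import structures.
Require Import Defs.
From mathcomp Require Import all_boot all_order all_algebra.
From mathcomp Require Import all_classical all_reals all_analysis.
From mathcomp Require Import measurable_realfun.

Set Implicit Arguments.
Unset Strict Implicit.
Unset Printing Implicit Defensive.

Import Order.TTheory GRing.Theory Num.Theory.
Import numFieldNormedType.Exports.

Local Open Scope classical_set_scope.
Local Open Scope ring_scope.

(** * Convergence to zero and sequences with halving steps *)

Lemma nonneg_cvge0P (R : realType) (u : nat -> \bar R) :
  (forall n, 0 <= u n)%E ->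
  (u n @[n --> \oo] --> 0%E <->
   forall e : R, 0 < e -> \forall n \near \oo, (u n < e%:E)%E).
Proof.
move=> u0; split=> [ucvg e e0|small].
  exact: (ucvg _ (@nbhs_open_ereal_lt _ 0 (fun=> e) e0)).
(* Values eventually below 1 are finite, so convergence can be tested on real parts. *)
have ufin : \forall n \near \oo, u n \is a fin_num.
  near=> n; rewrite ge0_fin_numE//.
  have : (u n < 1%:E)%E by near: n; exact: small.
  by move=> /lt_le_trans; apply; rewrite leey.
apply/fine_cvgP; split=> //; apply/cvgr0Pnorm_lt => e e0.
near=> n => /=; have nfin : u n \is a fin_num by near: n.
rewrite ger0_norm ?fine_ge0// -lte_fin fineK//.
by near: n; exact: small.
Unshelve. all: end_near. Qed.

(** The first step costs at most [delta k.+1], and so does the rest by induction from [k.+1];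
    halving makes the two fit into [delta k]. *)
Lemma geometric_tail_le (R : realType) (delta a : nat -> R) (k l : nat) :
  (forall n, 0 < delta n) -> (forall n, delta n.+1 <= delta n / 2) ->
  (forall n, (k <= n)%N -> `|a n - a n.+1| <= delta n.+1) ->
  `|a k - a (k + l)%N| <= delta k.
Proof.
move=> delta0 half; elim: l k => [|l IH] k step.
  by rewrite addn0 subrr normr0 ltW.
rewrite addnS -addSn (le_trans (ler_distD (a k.+1) _ _))//.
rewrite [leRHS]splitr lerD ?(le_trans _ (half k)) ?step//.
by apply: IH => n /ltnW; exact: step.
Qed.

Lemma halving_cvg0 (R : realType) (delta : nat -> R) :
  (forall n, 0 < delta n) -> (forall n, delta n.+1 <= delta n / 2) ->
  delta n @[n --> \oo] --> (0 : R).
Proof.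
move=> delta0 half.
have geo : geometric (delta 0%N) 2^-1 n @[n --> \oo] --> (0 : R).
  by apply: cvg_geometric; rewrite gtr0_norm// invf_lt1// ltr1n.
apply: (squeeze_cvgr _ (cvg_cst 0) geo); apply: nearW => n; rewrite ltW//=.
elim: n => [|n IH]; first by rewrite expr0 mulr1.
by rewrite (le_trans (half n))// exprSr mulrA ler_wpM2r.
Qed.

(** Completeness of the reals gives the limit, and the tail bound passes to it. Starting at [k]
    allows for points where the early steps are large. *)
Lemma geometric_cvg_le (R : realType) (delta a : nat -> R) (k : nat) :
  (forall n, 0 < delta n) -> (forall n, delta n.+1 <= delta n / 2) ->
  (forall n, (k <= n)%N -> `|a n - a n.+1| <= delta n.+1) ->
  exists2 b, a n @[n --> \oo] --> b & `|a k - b| <= delta k.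
Proof.
move=> delta0 half step.
have tail m l : (k <= m)%N -> `|a m - a (m + l)%N| <= delta m.
  move=> km; apply: geometric_tail_le => // n mn.
  by apply: step; exact: leq_trans mn.
have acvg : cvgn a.
  apply/cauchy_cvgP; apply: cauchy_exP => e e0.
  have [m km dm] : exists2 m, (k <= m)%N & delta m < e.
    near \oo => m; exists m; first by near: m; exact: nbhs_infty_ge.
    by near: m; apply: (cvgr_lt _ (halving_cvg0 delta0 half)).
  exists (a m); exists m => // n /= mn.
  by rewrite /ball /= -(subnKC mn) (le_lt_trans (tail _ _ km)).
exists (limn a) => //.
have cl : `|a k - a n| @[n --> \oo] --> `|a k - limn a|.
  by apply: cvg_norm; apply: cvgB => //; exact: cvg_cst.
apply: (cvgr_to_le cl); near=> n.
have kn : (k <= n)%N by near: n; exact: nbhs_infty_ge.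
by rewrite -(subnKC kn) tail.
Unshelve. all: end_near. Qed.

(** * Sets of small measure and small values of [norm0] *)

Section measure_small.
Context {R : realType} {d : measure_display} {X : measurableType d}.
Variable mu : nonadditive_measure R X.

(** Uniform form of (p.g.p.). If every radius 1/(n+1) failed, the bad pairs would have measures
    tending to 0 while their unions keep measure at least [e]. *)
Lemma pseudometric_generating_union_lt : pseudometric_generating mu ->
  forall e : R, 0 < e -> exists2 r : R, 0 < r &
  forall A B, measurable A -> measurable B ->
    (mu A < r%:E)%E -> (mu B < r%:E)%E -> (mu (A `|` B) < e%:E)%E.
Proof.
move=> pgp e e0; apply: contrapT => noR.
have /choice[AB HAB] (n : nat) : exists AB : set X * set X,
    [/\ measurable AB.1, measurable AB.2, (mu AB.1 < n.+1%:R^-1%:E)%E,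
        (mu AB.2 < n.+1%:R^-1%:E)%E & (e%:E <= mu (AB.1 `|` AB.2))%E].
  apply: contrapT => noAB; apply: noR; exists n.+1%:R^-1 => //.
  move=> A B mA mB muA muB; rewrite ltNge; apply/negP => eAB.
  by apply: noAB; exists (A, B).
have mA n : measurable (AB n).1 by have [] := HAB n.
have mB n : measurable (AB n).2 by have [] := HAB n.
have cv : maxe (mu (AB n).1) (mu (AB n).2) @[n --> \oo] --> 0%E.
  apply/nonneg_cvge0P => [n|r r0].
    by rewrite le_max nonadditive_ge0.
  near=> n; have [_ _ An Bn _] := HAB n.
  have nr : n.+1%:R^-1 < r.
    by near: n; exact: (near_infty_natSinv_lt (PosNum r0)).
  by rewrite gt_max (lt_trans An) ?(lt_trans Bn) ?lte_fin.
have mAB n : (0 <= mu ((AB n).1 `|` (AB n).2))%E.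
  by apply: nonadditive_ge0; exact: measurableU.
have [N _ /(_ N (leqnn N))] := (nonneg_cvge0P mAB).1 (pgp _ _ mA mB cv) _ e0.
have [_ _ _ _ eAB] := HAB N.
by rewrite /= ltNge eAB.
Unshelve. all: end_near. Qed.

Lemma norm0_has_lbound (f : {mfun X >-> R}) :
  lbound [set phi (c%:E + mu [set x | (c < `|f x|)%R])%E | c in [set c : R | 0 < c]] 0.
Proof.
move=> _ [c /= c0 <-]; rewrite -[leLHS](@atan0 R) -[leLHS]/(phi 0%:E).
rewrite phi_homo// adde_ge0 ?lee_fin ?(ltW c0)// nonadditive_ge0//.
exact: measurable_gt_norm.
Qed.

Lemma norm0_ge0 (f : {mfun X >-> R}) : 0 <= norm0 mu f.
Proof.
apply: lb_le_inf (@norm0_has_lbound f).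
by exists (phi (1%:E + mu [set x | (1 < `|f x|)%R])%E); exists 1 => /=.
Qed.

(** The infimum is tested at [c = e]. Together with [norm0_lt_atan] this translates between small
    [norm0] and smallness in measure. *)
Lemma norm0_le_atan (f : {mfun X >-> R}) (e : R) : 0 < e ->
  (mu [set x | (e < `|f x|)%R] <= e%:E)%E -> norm0 mu f <= atan (e + e).
Proof.
move=> e0 mue; have mu0 := nonadditive_ge0 mu (measurable_gt_norm f e).
apply: (@le_trans _ _ (phi (e%:E + mu [set x | (e < `|f x|)%R])%E)).
  by apply: ge_inf; [exists 0; exact: norm0_has_lbound|exists e].
rewrite -[leRHS]/(phi (e%:E + e%:E)%E).
by rewrite phi_homo ?leeD2l ?adde_ge0 ?lee_fin// ltW.
Qed.

(** Some [c] has [phi (c + mu {|f| > c}) < atan e], so by monotonicity of [phi] the sum is below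
    [e]. Hence [c < e], the measure at level [c] is below [e], and level [e] gives a smaller set. *)
Lemma norm0_lt_atan (f : {mfun X >-> R}) (e : R) : 0 < e ->
  norm0 mu f < atan e -> (mu [set x | (e < `|f x|)%R] < e%:E)%E.
Proof.
move=> e0 /inf_lt[|_ [c /= c0 <-] lte].
  by exists (phi (1%:E + mu [set x | (1 < `|f x|)%R])%E); exists 1 => /=.
have mu0 := nonadditive_ge0 mu (measurable_gt_norm f c).
have cmu : (c%:E + mu [set x | (c < `|f x|)%R] < e%:E)%E.
  rewrite ltNge; apply/negP => ec; move: lte; rewrite ltNge => /negP; apply.
  by apply: (@phi_homo R e%:E) => //; rewrite lee_fin ltW.
have ce : c < e by rewrite -lte_fin (le_lt_trans _ cmu)// leeDl.
apply: le_lt_trans cmu; apply: (@le_trans _ _ (mu [set x | (c < `|f x|)%R])).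
  apply: nonadditive_le; [exact: measurable_gt_norm..|].
  by move=> x /=; exact: lt_trans.
by rewrite leeDr// lee_fin ltW.
Qed.

End measure_small.

(** * Cauchy sequences in measure converge in measure *)

Section completeness_in_measure.
Context {R : realType} {d : measure_display} {X : measurableType d}.
Variable mu : nonadditive_measure R X.

(** Both [E k] and the segment starting at [k.+1] have measure below [delta k.+1], so the union
    hypothesis applies. The bound is uniform in [l], as the supremum in (C) demands. *)
Lemma bigcup_segment_lt (delta : nat -> R) (E : nat -> set X) (k l : nat) :
  (forall n, measurable (E n)) ->
  (forall n, delta n.+1 <= delta n) ->
  (forall n A B, measurable A -> measurable B ->
    (mu A < (delta n.+1)%:E)%E -> (mu B < (delta n.+1)%:E)%E ->
    (mu (A `|` B) < (delta n)%:E)%E) ->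
  (forall n, (mu (E n) < (delta n.+1)%:E)%E) ->
  (mu (\bigcup_(n in [set n | (k <= n <= k + l)%N]) E n) < (delta k)%:E)%E.
Proof.
move=> mE dS dU Edelta; elim: l k => [|l IH] k.
  rewrite (_ : [set n | _] = [set k]); last first.
    by apply/seteqP; split=> n /=; rewrite addn0 -eqn_leq; [move/eqP->|move->].
  by rewrite bigcup_set1 (lt_le_trans (Edelta k))// lee_fin.
rewrite (_ : [set n | _] = k |` [set n | (k.+1 <= n <= k.+1 + l)%N]); last first.
  apply/seteqP; split=> n /=; rewrite addnS addSn.
    by rewrite leq_eqVlt => /andP[/predU1P[<-|->]]; [left|right].
  by case=> [->|/andP[/ltnW-> ->//]]; rewrite leqnn ltnW// ltnS leq_addr.
rewrite bigcup_setU1; apply: dU => //; exact: bigcup_measurable.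
Qed.

Lemma fast_cauchy_cvg_in_measure (delta : nat -> R) (v : nat -> {mfun X >-> R}) :
  property_C mu ->
  (forall n, 0 < delta n) -> (forall n, delta n.+1 <= delta n / 2) ->
  (forall n A B, measurable A -> measurable B ->
    (mu A < (delta n.+1)%:E)%E -> (mu B < (delta n.+1)%:E)%E ->
    (mu (A `|` B) < (delta n)%:E)%E) ->
  (forall n, (mu [set x | (delta n.+1 < `|v n x - v n.+1 x|)%R]
    < (delta n.+1)%:E)%E) ->
  exists g : {mfun X >-> R},
    mu [set x | delta k < `|v k x - g x|] @[k --> \oo] --> (0%E : \bar R).
Proof.
move=> C delta0 half dU vdelta.
pose E n := [set x | delta n.+1 < `|v n x - v n.+1 x|].
pose tailE k := \bigcup_(n in [set n | (k <= n)%N]) E n.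
have mE n : measurable (E n) by exact: measurable_gt_normB.
have mtail k : measurable (tailE k) by exact: bigcup_measurable.
have dS n : delta n.+1 <= delta n.
  by rewrite (le_trans (half n))// ler_pdivrMr// ler_peMr ?ler1n// ltW.
have tail0 : mu (tailE k) @[k --> \oo] --> 0%E.
  apply: C => //; apply/nonneg_cvge0P => [k|e e0].
    apply: le_trans (ereal_sup_ubound _); last by exists 0%N.
    by apply: nonadditive_ge0; exact: bigcup_measurable.
  near=> k; apply: (@le_lt_trans _ _ (delta k)%:E).
    apply: ge_ereal_sup => _ [l _ <-]; apply: ltW; exact: bigcup_segment_lt.
  by rewrite lte_fin; near: k; apply: (cvgr_lt _ (halving_cvg0 delta0 half)).
(* The limit superior is measurable without any convergence and equals the limit off [tailE k].
   Where it is infinite [fine] returns 0; such points lie in every [tailE k]. *)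
pose g x := fine (limn_esup (fun n => (v n x)%:E)).
have mg : measurable_fun setT g.
  apply: (measurableT_comp (fine_measurable measurableT)).
  apply: measurable_fun_limn_esup => n; apply/measurable_EFinP.
  exact: measurable_funPT.
have [gm gmE] : exists gm : {mfun X >-> R}, gm =1 g.
  by exists (HB.pack_for {mfun X >-> R} g (isMeasurableFun.Build _ _ _ _ g mg)).
exists gm.
have sub k : [set x | delta k < `|v k x - gm x|] `<=` tailE k.
  move=> x /= lt_x; apply: contrapT => notE.
  have step n : (k <= n)%N -> `|v n x - v n.+1 x| <= delta n.+1.
    by move=> kn; rewrite leNgt; apply/negP => ?; apply: notE; exists n.
  have [b vb] := geometric_cvg_le delta0 half step.
  rewrite (_ : b = gm x) ?leNgt ?lt_x// gmE /g.
  have vbE : (v n x)%:E @[n --> \oo] --> b%:E.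
    by apply/cvg_EFin => //; exact: nearW.
  by rewrite (cvg_limn_einf_sup vbE).
apply: (squeeze_cvge _ (cvg_cst 0%E) tail0); apply: nearW => k.
rewrite nonadditive_ge0/=; last exact: measurable_gt_normB.
apply: nonadditive_le => //; exact: measurable_gt_normB.
Unshelve. all: end_near. Qed.

Lemma cauchy_in_measure_cvg (u : nat -> {mfun X >-> R}) :
  property_C mu -> pseudometric_generating mu ->
  (forall e : R, 0 < e -> exists n0, forall m n, (n0 <= m)%N -> (n0 <= n)%N ->
    (mu [set x | (e < `|u m x - u n x|)%R] < e%:E)%E) ->
  exists g : {mfun X >-> R}, forall e : R, 0 < e ->
    \forall n \near \oo, (mu [set x | (e < `|u n x - g x|)%R] < e%:E)%E.
Proof.
move=> C pgp ucauchy.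
have pgp_lt := pseudometric_generating_union_lt pgp.
(* Choice needs a value for every real [e], so positivity is assumed inside and 0 serves the other
   [e]. The bound [r <= e / 2] makes the iterates of [h] halve. *)
have /choice[h hP] (e : R) : exists r : R, 0 < e -> [/\ 0 < r, r <= e / 2 &
    forall A B, measurable A -> measurable B ->
    (mu A < r%:E)%E -> (mu B < r%:E)%E -> (mu (A `|` B) < e%:E)%E].
  have [e0|] := ltP 0 e; last by exists 0.
  have [r r0 rP] := pgp_lt _ e0; exists (Num.min r (e / 2)) => _; split.
  - by rewrite lt_min r0 divr_gt0.
  - by rewrite ge_min lexx orbT.
  move=> A B mA mB muA muB; apply: rP => //.
    by rewrite (lt_le_trans muA)// lee_fin ge_min lexx.
  by rewrite (lt_le_trans muB)// lee_fin ge_min lexx.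
have /choice[N NP] (e : R) : exists n0, 0 < e -> forall m n,
    (n0 <= m)%N -> (n0 <= n)%N ->
    (mu [set x | (e < `|u m x - u n x|)%R] < e%:E)%E.
  have [e0|] := ltP 0 e; last by exists 0%N.
  by have [n0 n0P] := ucauchy _ e0; exists n0.
pose delta n : R := iter n h 1.
have delta0 n : 0 < delta n by elim: n => //= n /hP[].
have half n : delta n.+1 <= delta n / 2 by have [] := hP _ (delta0 n).
(* The maximum puts [s n] past the thresholds of all [delta k.+1] with [k <= n], so [u (s n)] and
   [u (s n.+1)] are close at level [delta n.+1]. Indices may repeat. *)
pose s k := (\max_(j < k.+1) N (delta j.+1))%N.
have sN k n : (k <= n)%N -> (N (delta k.+1) <= s n)%N.
  move=> kn; pose F (j : 'I_n.+1) := N (delta j.+1).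
  exact: (@leq_bigmax _ F (Ordinal (kn : (k < n.+1)%N))).
have [||g g0] := @fast_cauchy_cvg_in_measure delta (u \o s) C delta0 half.
- by move=> n A B; have [_ _] := hP _ (delta0 n); exact.
- by move=> n; apply: NP => //; exact: sN.
exists g => e e0; have [r r0 rP] := pgp_lt _ e0.
(* [delta k < r] serves (p.g.p.), [delta k < e / 2] the triangle inequality. *)
have [k [dr de kr]] : exists k, [/\ delta k < r, delta k < e / 2 &
    (mu [set x | (delta k < `|u (s k) x - g x|)%R] < r%:E)%E].
  near \oo => k; exists k; split.
  - by near: k; exact: (cvgr_lt _ (halving_cvg0 delta0 half)).
  - by near: k; apply: (cvgr_lt _ (halving_cvg0 delta0 half)); rewrite divr_gt0.
  - near: k; move/nonneg_cvge0P: g0; apply => // k.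
    by apply: nonadditive_ge0; exact: measurable_gt_normB.
have dS : delta k.+1 <= delta k.
  by rewrite (le_trans (half k))// ler_pdivrMr// ler_peMr ?ler1n// ltW.
(* The first level is [delta k.+1] because [sN] places [s k] past the threshold [N (delta k.+1)]. *)
near=> n; apply: (@le_lt_trans _ _
  (mu ([set x | (delta k.+1 < `|u n x - u (s k) x|)%R] `|`
       [set x | (delta k < `|u (s k) x - g x|)%R]))).
  apply: nonadditive_le; first exact: measurable_gt_normB.
    by apply: measurableU; exact: measurable_gt_normB.
  move=> x /= ex; apply/orP; rewrite -implyNb -leNgt; apply/implyP => d1.
  rewrite ltNge; apply/negP => d2; move: ex; rewrite ltNge => /negP; apply.
  rewrite (le_trans (ler_distD (u (s k) x) _ _))// [leRHS]splitr.
  by rewrite lerD// ?(le_trans d1)// ?(le_trans d2)// ?(le_trans dS)// ltW.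
apply: rP => //; try exact: measurable_gt_normB.
apply: (@lt_trans _ _ (delta k.+1)%:E); last by rewrite lte_fin (le_lt_trans dS).
by apply: NP => //; [near: n; exact: nbhs_infty_ge|exact: sN].
Unshelve. all: end_near. Qed.

(** * From convergence in measure back to the two spaces *)

Lemma norm0_complete :
  property_C mu -> pseudometric_generating mu -> is_complete (norm0 mu).
Proof.
move=> C pgp u ucauchy.
have [e e0|g gP] := @cauchy_in_measure_cvg u C pgp.
  have [|n0 n0P] := ucauchy (atan e); first by rewrite -(@atan0 R) lt_atan.
  exists n0 => m n n0m n0n.
  by apply: (@norm0_lt_atan _ _ _ mu (u m - u n)) => //; exact: n0P.
exists g; apply/cvgr0Pnorm_lt => r r0.
(* [norm0_le_atan] will bound the norm by [atan (e + e)], so a level [e] making this less than [r]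
   is needed. *)
have atan_dbl : atan (e + e) @[e --> 0^'+] --> (0 : R).
  rewrite -[X in _ --> X](@atan0 R) -[X in _ --> atan X](addr0 0).
  apply: cvg_at_right_filter.
  by apply: continuous_cvg; [exact: continuous_atan|apply: cvgD; exact: cvg_id].
have [e e0 er] : exists2 e : R, 0 < e & atan (e + e) < r.
  near (0 : R)^'+ => e; exists e => //.
  by near: e; apply: (cvgr_lt _ atan_dbl).
near=> n; rewrite ger0_norm ?norm0_ge0// (le_lt_trans _ er)// norm0_le_atan// ltW//.
by near: n; exact: gP.
Unshelve. all: end_near. Qed.

(** By [normB] the norm of a difference of classes can be computed on any representatives. So [repr]
    turns a Cauchy sequence of classes into one of functions, and the class of its limit is the
    limit. *)
Lemma norm0_quot_complete (na : null_additive mu) :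
  is_complete (norm0 mu) -> is_complete (norm0_quot (mu := mu) (na := na)).
Proof.
have normB f g : norm0_quot (L0_class na f - L0_class na g) = norm0 mu (f - g).
  rewrite -norm0_quotE -[- L0_class na g]/(L0_opp (L0_class na g)).
  by rewrite L0_oppE L0_classD.
move=> complete u ucauchy.
have [e /ucauchy[n0 n0P]|g ug] := complete (fun n => repr (u n)).
  by exists n0 => m n n0m n0n; rewrite -normB !L0_class_repr; exact: n0P.
exists (L0_class na g); move: ug; rewrite /converges_to.
by under eq_fun do rewrite -normB L0_class_repr.
Qed.

End completeness_in_measure.

Theorem corollary5p5 (R : realType) (d : measure_display)
    (X : measurableType d) (mu : nonadditive_measure R X) :
  property_C mu -> pseudometric_generating mu ->
  is_complete (norm0 mu) /\
  (forall na : null_additive mu, is_complete (@norm0_quot R d X mu na)).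
Proof.
move=> C pgp; have complete := norm0_complete C pgp.
by split=> // na; exact: norm0_quot_complete.
Qed.
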